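(* Let $D$ be a digraph without useless arcs and let $k\geq 1$ be an integer. If $\ell(D)\geq 3k$, then $\ell_s(D)\geq k$, i.e. $D$ has an out-branching with at least $k$ leaves.
   Context: An out-tree of a digraph $D$ is a subgraph of $D$ that is a tree (ignoring arc directions) in which exactly one vertex, the root, has in-degree $0$ and every other vertex has in-degree $1$. An out-branching is a spanning out-tree. A leaf is a vertex of out-degree $0$ in the out-tree. $\ell(D)$ and $\ell_s(D)$ denote the maximum number of leaves over all out-trees and over all out-branchings of $D$, respectively. An arc of $D$ is useless if no out-branching of $D$ contains it. *)

(* Defs.v *)
(* A digraph D is a finite vertex type T with an arc relation
   E : rel T (arc u -> v iff E u v). *)
From mathcomp Require Import all_boot.
Set Implicit Arguments. Unset Strict Implicit. Unset Printing Implicit Defensive.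

Section Digraphs.
Variable T : finType.

Definition indeg (A : {set T * T}) (v : T) : nat := #|[set u | (u, v) \in A]|.
Definition outdeg (A : {set T * T}) (v : T) : nat := #|[set w | (v, w) \in A]|.

Definition urel (A : {set T * T}) : rel T := fun x y => ((x, y) \in A) || ((y, x) \in A).

(* (V, A) is a tree when arc directions are ignored: nonempty, connected,
   and with |A| = |V| - 1 (arcs counted as edges of a multigraph). *)
Definition is_undirected_tree (V : {set T}) (A : {set T * T}) : Prop :=
  [/\ V != set0,
      {in V &, forall x y, connect (urel A) x y}
    & #|A| = #|V| - 1].

Definition is_out_tree (E : rel T) (V : {set T}) (A : {set T * T}) : Prop :=
  [/\ {in A, forall a, [&& E a.1 a.2, a.1 \in V & a.2 \in V]},
      is_undirected_tree V A
    & exists2 r, r \in V &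
        indeg A r = 0 /\ {in V, forall v, v != r -> indeg A v = 1}].

Definition leaves (V : {set T}) (A : {set T * T}) : {set T} :=
  [set v in V | outdeg A v == 0].

Definition is_out_branching (E : rel T) (A : {set T * T}) : Prop :=
  is_out_tree E [set: T] A.

Definition useless_arc (E : rel T) (u v : T) : Prop :=
  E u v /\ ~ (exists A, is_out_branching E A /\ (u, v) \in A).

Definition no_useless_arcs (E : rel T) : Prop :=
  forall u v, ~ useless_arc E u v.

End Digraphs.

(* Main.v *)
(* Let K be the set of vertices from which everything is reachable.  Say that x
   dominates y when every path from K to y meets x.  Since the arc u -> v is
   not useless, v never dominates u.  Let r be the root of an out-tree with leaf
   set L, |L| >= 3k, let M be the leaves dominating r and X := L \ M.

   If s \in K, s \notin Y and every y \in Y is reachable from s without meeting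
   Y \ {y}, then growing a tree from s outside Y, attaching Y, and then
   attaching the other vertices gives an out-branching with at least |Y| leaves.

   If |X| >= 2k, a path from K to r meeting X in a set H with |H| <= |X| / 2
   exists, and Y := X \ H works: go to r, then follow the out-tree.

   Otherwise |M| >= k.  M is a chain for domination.  For v' preceding v in M, the
   tree path from r to v contains a vertex y dominated by v', not dominated by v
   and not dominating v.  So from v' one reaches v avoiding y and y avoiding v,
   and each step along the chain yields one more leaf, |M| in total. *)
Require Import Defs.
From mathcomp Require Import all_boot.
From mathcomp Require Import zify.
Set Implicit Arguments. Unset Strict Implicit. Unset Printing Implicit Defensive.

(** * Reachability with forbidden vertices *)

Section Reach.
Variables (T : finType) (E : rel T).
Implicit Types (x y z s : T) (S N X Y V U : {set T}).

Definition avoiding N : rel T := fun x y => E x y && (y \notin N).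

(** [avoiding] tests only the heads of arcs; the separate test on [s] makes the paths miss [N] at
    both ends. *)
Definition reach S N : {set T} :=
  [set x | [exists s in S, (s \notin N) && connect (avoiding N) s x]].

Lemma reach_source S N s : s \in S -> s \notin N -> s \in reach S N.
Proof.
by move=> sS sN; rewrite inE; apply/existsP; exists s; rewrite sS sN connect0.
Qed.

Lemma reach_step S N x y : x \in reach S N -> E x y -> y \notin N -> y \in reach S N.
Proof.
rewrite !inE => /existsP[s /and3P[sS sN sx]] Exy yN.
apply/existsP; exists s; rewrite sS sN /=.
by apply: connect_trans sx (connect1 _); rewrite /avoiding Exy.
Qed.

Lemma reach_ind S N (P : pred T) :
    {in S, forall s, s \notin N -> P s} ->
    (forall x y, P x -> E x y -> y \notin N -> P y) ->
  {in reach S N, forall x, P x}.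
Proof.
move=> Ps Pstep x; rewrite inE => /existsP[s /and3P[sS sN /connectP[p ep ->]]].
have := Ps s sS sN; elim: p s {sS sN} ep => //= y p IH s /andP[/andP[Esy yN] yp] Hs.
exact: IH yp (Pstep _ _ Hs Esy yN).
Qed.

Lemma reach_notin S N x : x \in reach S N -> x \notin N.
Proof. by apply: (@reach_ind S N (fun x => x \notin N)). Qed.

Lemma reachS S S' N N' :
  S \subset S' -> N' \subset N -> reach S N \subset reach S' N'.
Proof.
move=> sS sN; have sNn z : z \notin N -> z \notin N' by apply: contra; apply/subsetP.
apply/subsetP; apply: reach_ind => [s sS' /sNn|x y xR Exy /sNn].
  by apply: reach_source; apply: (subsetP sS).
exact: reach_step xR Exy.
Qed.

Lemma reach_trans S N z x : z \in reach S N -> x \in reach [set z] N -> x \in reach S N.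
Proof.
move=> zR; move: x; apply: reach_ind => [s /set1P->//|x y]; exact: reach_step.
Qed.

Lemma reach_sourceP S N x : x \in reach S N -> exists2 s, s \in S & x \in reach [set s] N.
Proof.
rewrite inE => /existsP[s /and3P[sS sN sx]]; exists s => //.
by rewrite inE; apply/existsP; exists s; rewrite set11 sN.
Qed.

(** Cut a path at its last vertex in [S]: the induction restarts at each visit to [S]. *)
Lemma reach_last_source S N x :
  x \in reach S N -> exists2 k, k \in S & x \in reach [set k] (N :|: (S :\ k)).
Proof.
move=> xR; suff /existsP[k /andP[kS kx]] :
  [exists k in S, x \in reach [set k] (N :|: (S :\ k))] by exists k.
move: x xR; apply: reach_ind => [s sS sN|x y /existsP[k /andP[kS kx]] Exy yN].
  apply/existsP; exists s; rewrite sS /=.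
  by apply: reach_source; rewrite ?set11 // !inE eqxx (negbTE sN).
case: (boolP (y \in S)) => yS; apply/existsP.
  exists y; rewrite yS /=.
  by apply: reach_source; rewrite ?set11 // !inE eqxx (negbTE yN).
exists k; rewrite kS /=; apply: reach_step kx Exy _.
by rewrite !inE (negbTE yN) (negbTE yS) andbF.
Qed.

(* F below is the first layer of X seen from S: it separates S from r, hence has
   at least two elements, and a path need meet it only once, namely at its last
   vertex k in Z :|: F. *)
Lemma half_hitting S X r :
    r \in reach S set0 -> {in X, forall x, r \in reach S [set x]} ->
  exists H : {set T}, [/\ H \subset X, 2 * #|H| <= #|X| & r \in reach S (X :\: H)].
Proof.
have [n] := ubnP #|X|; elim: n S X => // n IH S X ltXn r0 rX.
pose Z := reach S X.
case: (boolP (r \in Z)) => [rZ|rZ].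
  by exists set0; rewrite sub0set cards0 setD0.
pose F := [set x in X | (x \in S) || [exists z in Z, E z x]].
have FX : F \subset X by apply/subsetP=> x; rewrite inE => /andP[].
(* The first vertex of [X] on a path from [S] would lie in [F], so avoiding [F] already means
   avoiding [X]. *)
have ZF : reach S F \subset Z.
  apply/subsetP; apply: reach_ind => [s sS|x y xZ Exy]; rewrite inE.
    by rewrite sS andbT => sX; apply: reach_source.
  have -> : [exists z in Z, E z y] by apply/existsP; exists x; rewrite xZ.
  by rewrite orbT andbT => yX; apply: reach_step xZ Exy yX.
have F2 : 1 < #|F|.
  rewrite ltnNge; apply/negP=> F1; case/negP: rZ; apply: (subsetP ZF).
  have [F0|[f fF]] := set_0Vmem F; first by rewrite F0.
  have -> : F = [set f].
    by apply/esym/eqP; rewrite eqEcard sub1set fF cards1.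
  by apply: rX; apply: (subsetP FX).
pose S' := Z :|: F; pose X' := X :\: F.
have cX : #|X| = #|F| + #|X'| by rewrite -(cardsID F X) (setIidPr FX).
have SS' (N : {set T}) x : x \in reach S N -> x \in reach S' N.
  apply: subsetP; apply: reachS => //; apply/subsetP=> s sS.
  rewrite !inE sS /= andbT; case: (boolP (s \in X)) => sX; rewrite ?orbT // orbF.
  by have := reach_source sS sX; rewrite inE.
have [|||H' [H'X H'2 rH']] := IH S' X'.
- lia.
- exact: SS'.
- by move=> x /setDP[xX _]; apply: SS'; apply: rX.
have [k kS' rk] := reach_last_source rH'.
have H'sX : H' \subset X := subset_trans H'X (subsetDl _ _).
case/setUP: kS' => [kZ|kF].
  exists H'; split=> //; first lia.
  apply: (@reach_trans _ _ k).
    by apply: (subsetP (reachS (subxx _) (subsetDl _ _))) kZ.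
  apply: (subsetP (reachS (subxx _) _)) rk.
  apply/subsetP=> x /setDP[xX xH']; rewrite !inE xH' xX /=.
  case: (boolP (_ || [exists z in Z, E z x])) => xF //=.
  rewrite orbT andbT; apply: contraTneq xX => ->; exact: reach_notin kZ.
have kX := subsetP FX _ kF.
(* The extra element [k] is paid for by [F], whose at least two elements are missing from [X']. *)
exists (k |: H'); split.
- by rewrite subUset sub1set kX.
- by rewrite cardsU1; case: (k \notin H') => /=; lia.
have kN : k \notin X :\: (k |: H') by rewrite !inE eqxx.
apply: (@reach_trans _ _ k).
  move: kF; rewrite inE kX /= => /orP[kS|/existsP[z /andP[zZ Ezk]]].
    exact: reach_source.
  by apply: reach_step Ezk kN; apply: (subsetP (reachS (subxx _) (subsetDl _ _))) zZ.
apply: (subsetP (reachS (subxx _) _)) rk.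
apply/subsetP=> x; rewrite !inE negb_or => /andP[/andP[-> ->] ->] /=.
by case: (_ || [exists z in Z, E z x]); rewrite ?orbT.
Qed.

End Reach.

(** * Structure and growth of out-trees *)

Section OutTrees.
Variables (T : finType) (E : rel T).
Implicit Types (x y z s u v : T) (V U Y : {set T}) (A : {set T * T}).

Definition arcs A : rel T := fun x y => (x, y) \in A.

(** The root is a parameter so that it stays fixed while the tree grows. *)
Definition rooted_out_tree s V A : Prop :=
  [/\ {in A, forall a, [&& E a.1 a.2, a.1 \in V & a.2 \in V]},
      is_undirected_tree V A, s \in V, indeg A s = 0
    & {in V, forall v, v != s -> indeg A v = 1}].

Lemma rooted_out_treeP V A :
  is_out_tree E V A <-> exists s, rooted_out_tree s V A.
Proof.
split=> [[Aarcs Atree [s sV [s0 s1]]]|[s [Aarcs Atree sV s0 s1]]]; first by exists s.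
by split=> //; exists s.
Qed.

Lemma indeg0 A s x : indeg A s = 0 -> (x, s) \notin A.
Proof. by move/eqP; rewrite cards_eq0 => /eqP/setP/(_ x); rewrite !inE => ->. Qed.

Lemma indeg1 A v x y : indeg A v = 1 -> (x, v) \in A -> (y, v) \in A -> x = y.
Proof.
move/eqP/cards1P=> [w /setP Aw] xv yv.
by move: (Aw x) (Aw y); rewrite !inE xv yv => /esym/eqP-> /esym/eqP->.
Qed.

Lemma connect_last_arc (e : rel T) x y :
  connect e x y -> x = y \/ exists2 z, connect e x z & e z y.
Proof.
case/connectP=> p; elim/last_ind: p y => [|p z _] y /=; first by left.
rewrite last_rcons rcons_path => /andP[ep ez] ->; right; exists (last x p) => //.
by apply/connectP; exists p.
Qed.

Lemma connect_leave (e : rel T) (P : pred T) x y :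
    connect e x y -> P x -> ~~ P y ->
  exists a b, [/\ P a, ~~ P b, e a b & connect e b y].
Proof.
case/connectP=> p; elim: p x => [|z p IH] x /=; first by move=> _ -> ->.
move=> /andP[exz ep] ey Px nPy; case: (boolP (P z)) => Pz; first exact: (IH z).
by exists x, z; split=> //; apply/connectP; exists p.
Qed.

Section Rooted.
Variables (s : T) (V : {set T}) (A : {set T * T}).
Hypothesis tree : rooted_out_tree s V A.

(** Walk along an undirected path from [s]. An arc used backwards must, by in-degree 1, be the last
    arc of the directed path found so far; dropping that arc gives the next directed path. *)
Lemma tree_connect v : v \in V -> connect (arcs A) s v.
Proof.
case: tree => Aarcs [_ Aconn _] sV s0 s1 vV.
case/connectP: (Aconn s v sV vV) => p ep ->.
elim/last_ind: p ep => [|p y IH] /=; first by rewrite connect0.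
rewrite last_rcons rcons_path => /andP[/IH sx /orP[xy|yx]].
  exact: connect_trans sx (connect1 _).
case: (connect_last_arc sx) => [ex|[z sz zx]].
  by rewrite -ex (negbTE (indeg0 _ s0)) in yx.
have xs : last s p != s.
  by apply: contraTneq zx => ->; rewrite /arcs (negbTE (indeg0 _ s0)).
have /and3P[_ _ xV] := Aarcs _ yx.
by rewrite (indeg1 (s1 _ xV xs) yx zx).
Qed.

(** Were [u] below [v], in-degree 1 would put every parent of a descendant of [v] below [v] too; yet
    the path from [s], which has no parent, must enter these descendants from outside. *)
Lemma tree_acyclic u v : (u, v) \in A -> ~~ connect (arcs A) v u.
Proof.
case: tree => Aarcs _ sV s0 s1 uv; apply/negP=> vu.
have /and3P[_ uV vV] := Aarcs _ uv.
have vs : v != s by apply: contraTneq uv => ->; apply: indeg0.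
have ns : ~~ connect (arcs A) v s.
  apply/negP=> /connect_last_arc[e|[z _ zs]]; first by rewrite e eqxx in vs.
  by have := indeg0 z s0; rewrite -/(arcs A z s) zs.
have nnu : ~~ ~~ connect (arcs A) v u by rewrite vu.
have [a [b [na]]] :=
  connect_leave (P := fun x => ~~ connect (arcs A) v x) (tree_connect uV) ns nnu.
rewrite negbK => vb ab _; case/negP: na.
have /and3P[_ _ bV] := Aarcs _ ab.
case: (connect_last_arc vb) => [e|[z vz zb]].
  by rewrite -e in ab; rewrite (indeg1 (s1 _ vV vs) ab uv).
have bs : b != s by apply: contraTneq ab => ->; apply: indeg0.
by rewrite (indeg1 (s1 _ bV bs) ab zb).
Qed.

(** Every vertex on the tree path from [s] to [u] reaches [u], which [v] does not, by acyclicity. *)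
Lemma tree_arc_reach u v : (u, v) \in A -> u \in reach E [set s] [set v].
Proof.
move=> uv; case: tree => Aarcs _ sV s0 s1.
have /and3P[_ uV vV] := Aarcs _ uv.
have notv z : connect (arcs A) z u -> z \notin [set v].
  by move=> zu; rewrite inE; apply: contraTneq zu => ->; apply: tree_acyclic.
have su := tree_connect uV.
have sR : s \in reach E [set s] [set v] by apply: reach_source; rewrite ?set11 ?notv.
apply: contraT => uR.
have [a [b [aR bR ab bu]]] :=
  connect_leave (P := mem (reach E [set s] [set v])) su sR uR.
case/negP: bR; apply: reach_step aR _ (notv _ bu).
by have /and3P[] := Aarcs _ ab.
Qed.

Lemma add_arc u v :
    u \in V -> v \notin V -> E u v ->
  rooted_out_tree s (v |: V) ((u, v) |: A).
Proof.
case: tree => Aarcs [V0 Aconn cA] sV s0 s1 uV vV Euv.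
have uvA : (u, v) \notin A by apply: contra vV => /Aarcs/and3P[].
have vs : v != s by apply: contraNneq vV => ->.
have indegE x : x != v -> indeg ((u, v) |: A) x = indeg A x.
  move=> xv; apply: eq_card => y; rewrite !inE xpair_eqE.
  by rewrite (negbTE xv) andbF.
split.
- move=> [a b] /setU1P[[-> ->]|/Aarcs/and3P[/= -> aV bV]] /=.
    by rewrite Euv !inE eqxx uV orbT.
  by rewrite !inE aV bV !orbT.
- split.
  + by apply/set0Pn; exists s; rewrite !inE sV orbT.
  + have sub : subrel (urel A) (connect (urel ((u, v) |: A))).
      move=> x y /orP xy; apply: connect1.
      by rewrite /urel !inE; case: xy => ->; rewrite !orbT.
    have con1 x y : x \in V -> y \in V -> connect (urel ((u, v) |: A)) x y.
      by move=> xV yV; apply: (connect_sub sub); apply: Aconn.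
    have uv1 : urel ((u, v) |: A) u v by rewrite /urel !inE eqxx.
    have vu1 : urel ((u, v) |: A) v u by rewrite /urel !inE eqxx orbT.
    move=> x y /setU1P[->|xV] /setU1P[->|yV]; first exact: connect0.
    * exact: connect_trans (connect1 vu1) (con1 _ _ uV yV).
    * exact: connect_trans (con1 _ _ xV uV) (connect1 uv1).
    * exact: con1.
  + rewrite !cardsU1 uvA vV cA.
    have : 0 < #|V| by apply/card_gt0P; exists s.
    lia.
- by rewrite !inE sV orbT.
- by rewrite indegE // eq_sym.
- move=> x /setU1P[->|xV] xs.
    rewrite /indeg -(cards1 u); apply: eq_card => y; rewrite !inE xpair_eqE eqxx andbT.
    case: (y == u) => //=; apply/negP=> /Aarcs/and3P[_ _ /=].
    by rewrite (negbTE vV).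
  by rewrite indegE ?s1 //; apply: contraNneq vV => <-.
Qed.

Lemma outdeg0 u : (outdeg A u == 0) = [forall x, (u, x) \notin A].
Proof.
rewrite cards_eq0; apply/eqP/forallP => [/setP H x|H].
  by have := H x; rewrite !inE => ->.
by apply/setP=> x; rewrite !inE (negbTE (H x)).
Qed.

(** Only [u] can stop being a leaf, and the new leaf [v] makes up for it. *)
Lemma add_arc_leaves u v :
    v \notin V -> u \in V ->
  #|leaves V A| <= #|leaves (v |: V) ((u, v) |: A)|.
Proof.
case: tree => Aarcs _ _ _ _ vV uV.
have vleaf : v \in leaves (v |: V) ((u, v) |: A).
  rewrite !inE eqxx /= cards_eq0; apply/eqP/setP=> x; rewrite !inE xpair_eqE.
  have -> : (v == u) = false by apply: contraNF vV => /eqP->.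
  by apply/negP=> /Aarcs/and3P[_ /= vV' _]; rewrite vV' in vV.
have sub : leaves V A :\ u \subset leaves (v |: V) ((u, v) |: A) :\ v.
  apply/subsetP=> x; rewrite !inE => /and3P[xu xV /eqP x0].
  have -> : x != v by apply: contraNneq vV => <-.
  rewrite xV orbT /= -x0; apply/eqP/eq_card=> y.
  by rewrite !inE xpair_eqE (negbTE xu).
rewrite (cardsD1 u) (cardsD1 v (leaves (v |: V) _)) vleaf.
by apply: leq_add (subset_leq_card sub); case: (_ \in _).
Qed.

End Rooted.

Lemma rooted_out_tree1 s : rooted_out_tree s [set s] set0.
Proof.
split; rewrite ?set11 //.
- by move=> a; rewrite in_set0.
- split; rewrite ?cards0 ?cards1 //; first by apply/set0Pn; exists s; rewrite set11.
  by move=> x y /set1P-> /set1P->; apply: connect0.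
- by apply: eq_card0 => x; rewrite !inE.
- by move=> v /set1P->; rewrite eqxx.
Qed.

(** Arcs leaving the tree inside the reachable set are added one at a time; none lowers the number
    of leaves. *)
Lemma grow_tree s N V A :
    rooted_out_tree s V A -> V \subset reach E [set s] N ->
  exists A', rooted_out_tree s (reach E [set s] N) A' /\
             #|leaves V A| <= #|leaves (reach E [set s] N) A'|.
Proof.
set U := reach _ _ _.
have [n] := ubnP (#|U :\: V|); elim: n V A => // n IH V A ltn tree VU.
have sV : s \in V by case: tree.
case: (boolP (U \subset V)) => UV.
  have <- : V = U by apply/eqP; rewrite eqEsubset VU.
  by exists A.
have [u [v [uV vV Euv vU]]] : exists u v, [/\ u \in V, v \notin V, E u v & v \in U].
  case: (boolP [exists u in V, exists v, [&& v \notin V, E u v & v \in U]]).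
    by case/exists_inP=> u uV /existsP[v /and3P[]]; exists u, v.
  move/exists_inPn=> H; case/subsetP: UV; apply: reach_ind => [x /set1P->//|x y xV Exy yN].
  apply: contraT => yV; have /existsPn/(_ y) := H x xV.
  by rewrite yV Exy (reach_step (subsetP VU _ xV) Exy yN).
have [||A' [tree' le']] := IH _ _ _ (add_arc tree uV vV Euv).
- have vUV : v \in U :\: V by rewrite inE vV.
  have -> : U :\: (v |: V) = (U :\: V) :\ v.
    by apply/setP=> x; rewrite !inE negb_or andbA.
  by move: ltn; rewrite (cardsD1 v) vUV; lia.
- by rewrite subUset sub1set vU.
exists A'; split=> //; apply: leq_trans le'; exact: (add_arc_leaves tree).
Qed.

Lemma attach_leaves s V A Y :
    rooted_out_tree s V A -> [disjoint V & Y] ->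
    {in Y, forall y, exists2 u, u \in V & E u y} ->
  exists A', rooted_out_tree s (V :|: Y) A' /\ Y \subset leaves (V :|: Y) A'.
Proof.
move=> tree dis par.
(* The induction carries the stronger claim that all arcs start in [V], which leaves the vertices of
   [Y] without out-arcs. *)
suff [A' [tree' src]] : exists A', rooted_out_tree s (V :|: Y) A' /\
    {in A', forall a, a.1 \in V}.
  exists A'; split=> //; apply/subsetP=> y yY.
  rewrite !inE yY orbT /= outdeg0; apply/forallP=> x; apply/negP=> /src /= yV.
  by rewrite (disjointFr dis yV) in yY.
have [n] := ubnP #|Y|; elim: n Y dis par => // n IH Y dis par ltn.
have [->|[y yY]] := set_0Vmem Y.
  by exists A; rewrite setU0; split=> //; case: tree => Aarcs _ _ _ _ a /Aarcs/and3P[].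
have sYY : Y :\ y \subset Y by apply: subsetDl.
have [|||A' [tree' src]] := IH (Y :\ y).
- exact: disjointWr sYY dis.
- by move=> z /(subsetP sYY); apply: par.
- by move: ltn; rewrite (cardsD1 y Y) yY; lia.
have [u uV Euy] := par y yY.
have yV : y \notin V by rewrite (disjointFl dis yY).
exists ((u, y) |: A'); split; last by move=> a /setU1P[->|/src].
have -> : V :|: Y = y |: (V :|: (Y :\ y)) by rewrite setUCA setD1K.
by apply: (add_arc tree'); rewrite ?inE ?uV ?eqxx ?orbF.
Qed.

End OutTrees.

(** * Out-branchings with many leaves *)

Section Main.
Variables (T : finType) (E : rel T).
Implicit Types (x y z s u v w r : T) (V U Y M : {set T}) (A : {set T * T}).

(** This is K: exactly the possible roots of an out-branching. *)
Definition roots : {set T} := [set s | [forall x, connect E s x]].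

Lemma reach_root s x : s \in roots -> x \in reach E [set s] set0.
Proof.
rewrite inE => /forallP/(_ x) sx; apply: contraT => xR.
have sR : s \in reach E [set s] set0 by apply: reach_source; rewrite ?set11 ?in_set0.
have [a [b [aR bR ab _]]] :=
  connect_leave (P := mem (reach E [set s] set0)) sx sR xR.
by case/negP: bR; apply: reach_step aR ab _; rewrite in_set0.
Qed.

Lemma branching_of_reach s Y :
    s \in roots ->
    {in Y, forall y, exists2 u, u \in reach E [set s] Y & E u y} ->
  exists A, is_out_branching E A /\ #|Y| <= #|leaves [set: T] A|.
Proof.
move=> sK par.
have sY : s \notin Y.
  apply/negP=> sY; have [u uR _] := par s sY.
  by move: uR; rewrite inE => /existsP[t /and3P[/set1P->]]; rewrite sY.
have sR : s \in reach E [set s] Y by apply: reach_source; rewrite ?set11.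
have [|A1 [tree1 _]] := @grow_tree _ E s Y _ _ (rooted_out_tree1 E s).
  by rewrite sub1set.
have [|A2 [tree2 YA2]] := attach_leaves tree1 (Y := Y) _ par.
  by rewrite disjoint_subset; apply/subsetP=> x /reach_notin.
have all_reached : reach E [set s] set0 = setT.
  by apply/setP=> x; rewrite in_setT reach_root.
(* This growth may turn vertices of [Y] into inner ones, but the number of leaves does not drop. *)
have [|A3 [tree3 le3]] := @grow_tree _ E s set0 _ _ tree2.
  by rewrite all_reached subsetT.
rewrite all_reached in tree3 le3; exists A3; split; first by apply/rooted_out_treeP; exists s.
exact: leq_trans (subset_leq_card YA2) le3.
Qed.

(** * Domination when every arc is useful *)

Section NoUseless.
Hypothesis useful : no_useless_arcs E.

(** An out-branching containing the arc has its root in K, and its path to [u] misses [v]. *)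
Lemma useful_arc u v : E u v -> exists2 s, s \in roots & u \in reach E [set s] [set v].
Proof.
move=> Euv.
suff /exists_inP : [exists s in roots, u \in reach E [set s] [set v]] by [].
apply: contraT => none; case: (useful (u := u) (v := v)).
split=> // -[A [/rooted_out_treeP[s tree] uvA]].
case/exists_inP: none; exists s; last exact: (tree_arc_reach tree).
rewrite inE; apply/forallP=> x; have := tree_connect tree (in_setT x).
apply: connect_sub => a b ab; apply: connect1.
by case: tree => Aarcs _ _ _ _; case/and3P: (Aarcs _ ab).
Qed.

Lemma useful_arc_roots u v : E u v -> u \in reach E roots [set v].
Proof.
case/useful_arc=> s sK; apply: subsetP; apply: reachS => //; by rewrite sub1set.
Qed.

Definition dominated x : {set T} := ~: reach E roots [set x].

Lemma dominatedE x y : (y \in dominated x) = (y \notin reach E roots [set x]).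
Proof. by rewrite inE. Qed.

Lemma dominated_pred x u v : E u v -> v \in dominated x -> v != x -> u \in dominated x.
Proof.
rewrite !dominatedE => Euv vR vx; apply: contra vR => uR.
by apply: reach_step uR Euv _; rewrite inE.
Qed.

Lemma dominated_self x : x \in dominated x.
Proof. by rewrite dominatedE; apply/negP=> /reach_notin; rewrite set11. Qed.

(** A path from K avoiding [w] cannot meet [v], since it would then reach [v] without [w]. *)
Lemma dominated_sub v w : v \in dominated w -> dominated v \subset dominated w.
Proof.
rewrite dominatedE /dominated setCS => vR.
pose P x := (x \in reach E roots [set w]) && (x \in reach E roots [set v]).
apply/subsetP=> x xR; suff /andP[] : P x by [].
move: x xR; apply: reach_ind; rewrite /P.
  move=> s sK sw; have sR := reach_source E sK sw; rewrite sR.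
  by apply: reach_source => //; rewrite inE; apply: contraNneq vR => <-.
move=> x y /andP[xw xv] Exy yw; have yR := reach_step xw Exy yw; rewrite yR.
by apply: reach_step xv Exy _; rewrite inE; apply: contraNneq vR => <-.
Qed.

(** If neither dominates the other, every vertex of a path from K to [r] is reachable avoiding [v]
    or avoiding [w]: at [v] one switches to a path avoiding [w], and conversely. *)
Lemma dominators_total (s0 : T) v w r :
    s0 \in roots -> r \in dominated v -> r \in dominated w -> v != w ->
  (v \in dominated w) || (w \in dominated v).
Proof.
move=> s0K; rewrite !dominatedE => rv rw vw; rewrite -negb_and; apply/negP=> /andP[vR wR].
have : r \in reach E roots set0.
  by apply: subsetP (reach_root r s0K); apply: reachS => //; rewrite sub1set.
suff H : {in reach E roots set0, forall x,
    (x \in reach E roots [set v]) || (x \in reach E roots [set w])}.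
  by move/H; rewrite (negbTE rv) (negbTE rw).
apply: reach_ind => [s sK _|x y xR Exy _].
  case: (eqVneq s v) => [->|sv]; first by rewrite vR orbT.
  by rewrite reach_source // inE.
case: (eqVneq y v) => [->|yv]; first by rewrite vR orbT.
case: (eqVneq y w) => [->|yw]; first by rewrite wR.
by case/orP: xR => xR; rewrite (reach_step xR Exy) ?inE ?orbT.
Qed.

(* The disjointness lets a later step extend the tree below v, inside
   [dominated v], without touching the leaves already secured. *)
Definition good s v Y : Prop :=
  [/\ s \in roots, v \in Y, [disjoint Y :\ v & dominated v]
    & {in Y, forall y, exists2 u, u \in reach E [set s] Y & E u y}].

(** Follow a path from K to [x] avoiding [y]. As long as no arc into [x] starts in the region
    reached from [s] outside [Y'], each vertex of the path is in that region or not dominated by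
    [v']; but [x] itself is neither. *)
Lemma good_extend_parent s v v' Y x y :
    let Y' := x |: (y |: (Y :\ v')) in
    [disjoint Y :\ v' & dominated v'] -> v' \in reach E [set s] Y' ->
    x \in dominated v' -> x \in reach E roots [set y] ->
  exists2 u, u \in reach E [set s] Y' & E u x.
Proof.
move=> Y' dis v'R xv' xy.
case: (boolP [exists u in reach E [set s] Y', E u x]) => [/exists_inP//|none].
suff H : {in reach E roots [set y], forall z,
    (z \in reach E roots [set v']) || (z \in reach E [set s] Y')}.
  case/orP: (H x xy) => [|/reach_notin]; last by rewrite !inE eqxx.
  by rewrite dominatedE in xv'; rewrite (negbTE xv').
apply: reach_ind => [t tK _|z w zR Ezw wy].
  case: (eqVneq t v') => [->|tv]; first by rewrite v'R orbT.
  by rewrite reach_source // inE.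
case: (eqVneq w v') => [->|wv']; first by rewrite v'R orbT.
case/orP: zR => zR; first by rewrite (reach_step zR Ezw) ?inE.
case: (boolP (w \in Y')) => wY'; last by rewrite (reach_step zR Ezw) ?orbT.
case/setU1P: wY' => [wx|].
  by case/negP: none; apply/exists_inP; exists z => //; rewrite -wx.
case/setU1P=> [wy'|wY]; first by rewrite wy' set11 in wy.
by have := disjointFr dis wY; rewrite dominatedE => /negbFE ->.
Qed.

(** The vertex [v'] is given up as a leaf and serves to reach both [v] and [y]. *)
Lemma good_extend s v' Y v y :
    good s v' Y -> v != v' -> v \in dominated v' -> y \in dominated v' ->
    y \in reach E roots [set v] -> v \in reach E roots [set y] ->
  good s v (v |: (y |: (Y :\ v'))) /\ #|v |: (y |: (Y :\ v'))| = #|Y|.+1.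
Proof.
move=> [sK v'Y dis par] vv' vD yD yv vy; set Y' := v |: _.
have yv' : y != v' by apply: contraTneq vy => ->; rewrite -dominatedE.
have v_y : v != y by apply: contraTneq vy => ->; rewrite -dominatedE dominated_self.
have notY z : z \in dominated v' -> z \notin Y :\ v' by move=> zD; rewrite (disjointFl dis).
have v'Y' : v' \notin Y' by rewrite !inE eqxx eq_sym (negbTE vv') eq_sym (negbTE yv').
(* Paths from [s] avoiding [Y] avoid [v'], so they stay outside [dominated v'], which contains both
   new leaves. *)
have RR : reach E [set s] Y \subset reach E [set s] Y'.
  pose P z := (z \in reach E [set s] Y') && (z \in reach E roots [set v']).
  apply/subsetP=> z zR; suff /andP[] : P z by [].
  have avoid z1 : z1 \notin Y -> z1 \in reach E roots [set v'] -> z1 \notin Y'.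
    move=> z1Y z1R; rewrite !inE negb_or negb_or (negbTE z1Y) andbF.
    by apply/and3P; split=> //; apply: contraTneq z1R => ->; rewrite -dominatedE.
  have notv' z1 : z1 \notin Y -> z1 \notin [set v'].
    by rewrite inE; apply: contraNneq => ->.
  move: z zR; apply: reach_ind; rewrite /P.
    move=> t /set1P-> sY; have sR := reach_source E sK (notv' _ sY).
    by rewrite sR reach_source ?set11 ?avoid.
  move=> a b /andP[aR aR'] Eab bY; have bR' := reach_step aR' Eab (notv' _ bY).
  by rewrite bR' (reach_step aR Eab) ?avoid.
have v'R : v' \in reach E [set s] Y'.
  by have [u uR Euv'] := par v' v'Y; apply: reach_step (subsetP RR _ uR) Euv' v'Y'.
split; last first.
  rewrite !cardsU1 notY // (cardsD1 v' Y) v'Y.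
  have -> : v \notin y |: Y :\ v' by rewrite in_setU1 negb_or v_y notY.
  by rewrite !add1n.
split=> //; first by rewrite !inE eqxx.
- rewrite disjoint_subset; apply/subsetP=> z.
  rewrite in_setD1 => /andP[zv /setU1P[zv_eq|]]; first by rewrite zv_eq eqxx in zv.
  case/setU1P=> [->|zY]; first by rewrite inE dominatedE negbK.
  rewrite inE; apply: contraFN (disjointFr dis zY); apply: subsetP; exact: dominated_sub.
- move=> z /setU1P[->|/setU1P[->|zY]].
  + exact: good_extend_parent.
  + rewrite /Y' setUCA; rewrite /Y' setUCA in v'R; exact: good_extend_parent.
  + have [|u uR Euz] := par z; first by case/setD1P: zY.
    by exists u => //; apply: (subsetP RR).
Qed.

(** * Leaves of an out-tree that dominate its root *)

Section Tree.
Variables (r : T) (V : {set T}) (A : {set T * T}).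
Hypothesis tree : rooted_out_tree E r V A.

Lemma tree_arc u v : (u, v) \in A -> E u v.
Proof. by case: tree => Aarcs _ _ _ _ /Aarcs/and3P[]. Qed.

Lemma leaf_in v : v \in leaves V A -> v \in V.
Proof. by rewrite inE => /andP[]. Qed.

Lemma leaf_no_arc v x : v \in leaves V A -> (v, x) \notin A.
Proof. by rewrite inE outdeg0 => /andP[_ /forallP]. Qed.

Lemma leaf_parent v : v \in V -> v != r -> exists2 u, connect (arcs A) r u & (u, v) \in A.
Proof.
move=> vV vr; case: (connect_last_arc (tree_connect tree vV)) => [e|//].
by rewrite e eqxx in vr.
Qed.

(** [y] is where the tree path from [r] to [v] leaves [dominated v]. It does leave, since the parent
    of [v] has a useful arc to [v] and so is not dominated by [v]. *)
Lemma exists_detour v v' :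
    v \in leaves V A -> v' \in leaves V A -> r != v -> v != v' ->
    r \in dominated v -> v \in dominated v' ->
  exists y, [/\ y \in dominated v', y \in reach E roots [set v]
              & v \in reach E roots [set y]].
Proof.
move=> vL v'L rv vv' rD vD.
have vV := leaf_in vL.
have [u ru uvA] : exists2 u, connect (arcs A) r u & (u, v) \in A.
  by apply: leaf_parent => //; rewrite eq_sym.
have Euv := tree_arc uvA.
have uD : u \notin dominated v by rewrite dominatedE negbK useful_arc_roots.
have [x [y [xD yD xy yu]]] := connect_leave (P := mem (dominated v)) ru rD uD.
exists y; split; last 1 first.
(* If [y] dominated [v], it would dominate [x] by transitivity, against the usefulness of the arc
   from [x] to [y]. *)
- apply: contraT; rewrite -dominatedE => vy.
  have xR := useful_arc_roots (tree_arc xy).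
  have := subsetP (dominated_sub vy) _ xD.
  by rewrite dominatedE xR.
(* Domination by [v'] is carried backwards from [v] along the tree path. Only meeting [v'] could
   stop it, but the vertices passed have out-arcs and [v'] is a leaf. *)
- suff H p z : path (arcs A) z p -> last z p = u -> z \in dominated v'.
    by case/connectP: yu => p yp ep; apply: (H p).
  elim: p z => [|b p IH] z /= => [_ ->|/andP[zb bp] lb].
    exact: dominated_pred Euv vD vv'.
  apply: dominated_pred (tree_arc zb) (IH _ bp lb) _.
  apply/eqP=> eb; case: p bp lb {IH} => [|c p] /= => [_|/andP[bc _] _].
    by move=> eu; move: (leaf_no_arc v v'L); rewrite -eb eu uvA.
  by move: (leaf_no_arc c v'L); rewrite -eb; rewrite /arcs in bc; rewrite bc.
- by move: yD; rewrite /= dominatedE negbK.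
Qed.

Lemma dominating_leaves_good M :
    M != set0 -> M \subset leaves V A -> r \notin M ->
    {in M, forall v, r \in dominated v} ->
  exists v s Y, [/\ v \in M, {in M, forall w, v \in dominated w}, good s v Y & #|Y| = #|M|].
Proof.
have [n] := ubnP #|M|; elim: n M => // n IH M ltn M0 ML rM MD.
have [v0 v0M] := set0Pn _ M0.
have parent v : v \in M -> exists2 u, connect (arcs A) r u & (u, v) \in A.
  move=> vM; have vV := leaf_in (subsetP ML _ vM).
  by apply: leaf_parent => //; apply: contraNneq rM => <-.
have [s0 s0K] : exists s0, s0 \in roots.
  by have [u _ /tree_arc/useful_arc[s sK _]] := parent v0 v0M; exists s.
(* The last element of the chain is the one with the smallest dominated set; it is removed for the
   induction. *)
pose v := [arg min_(v < v0 in M) #|dominated v|].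
have [vM vmin] : v \in M /\ {in M, forall w, #|dominated v| <= #|dominated w|}.
  by rewrite /v; case: arg_minnP => // i iM imin; split.
have vlast : {in M, forall w, v \in dominated w}.
  move=> w wM; case: (eqVneq v w) => [->|vw]; first exact: dominated_self.
  case/orP: (dominators_total s0K (MD v vM) (MD w wM) vw) => // wv.
  have /eqP-> : dominated w == dominated v by rewrite eqEcard dominated_sub ?vmin.
  exact: dominated_self.
have [M1|M1] := eqVneq (M :\ v) set0.
  have [u _ uv] := parent v vM.
  have [s sK uR] := useful_arc (tree_arc uv).
  exists v, s, [set v]; split=> //; last by rewrite -(setD1K vM) M1 setU0 !cards1.
  split; rewrite ?set11 //; first by rewrite setDv disjoints_subset sub0set.
  by move=> y /set1P->; exists u => //; apply: tree_arc.
have sM : M :\ v \subset M by apply: subsetDl.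
have [||||v' [s [Y [v'M v'last gY cY]]]] := IH (M :\ v) _ M1.
- by move: ltn; rewrite (cardsD1 v M) vM; lia.
- exact: subset_trans sM ML.
- by apply: contra rM; apply: subsetP.
- by move=> w /(subsetP sM)/MD.
have [v'v v'M'] : v' != v /\ v' \in M by apply/andP; rewrite -in_setD1.
have rv : r != v by apply: contraNneq rM => ->.
have vv' : v != v' by rewrite eq_sym.
have [y [yD yv vy]] := exists_detour (subsetP ML _ vM) (subsetP ML _ v'M') rv vv'
  (MD v vM) (vlast _ v'M').
have [gY' cY'] := good_extend gY vv' (vlast _ v'M') yD yv vy.
exists v, s, (v |: (y |: (Y :\ v'))); split=> //.
by rewrite cY' cY (cardsD1 v M) vM.
Qed.

End Tree.
End NoUseless.
End Main.

(* l(D) >= 3k  <->  some out-tree has at least 3k leaves;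
   l_s(D) >= k <->  some out-branching has at least k leaves. *)
Theorem theorem3 (T : finType) (E : rel T) (k : nat) :
  no_useless_arcs E -> 1 <= k ->
  (exists V A, is_out_tree E V A /\ 3 * k <= #|leaves V A|) ->
  exists A, is_out_branching E A /\ k <= #|leaves [set: T] A|.
Proof.
move=> useful k1 [V [A [/rooted_out_treeP[r tree] kL]]].
(* A root that is a leaf is the only vertex of its tree, but there are at least three leaves. *)
have rL : r \notin leaves V A.
  apply/negP=> rL.
  have : leaves V A \subset [set r].
    apply/subsetP=> x /leaf_in xV.
    case/connectP: (tree_connect tree xV) => -[|y p] /=.
      by move=> _ ->; rewrite set11.
    by case/andP=> ry _ _; move: (leaf_no_arc y rL); rewrite -/(arcs A r y) ry.
  by move/subset_leq_card; rewrite cards1; lia.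
have parent v : v \in leaves V A -> exists2 u, connect (arcs A) r u & (u, v) \in A.
  move=> vL; apply: (leaf_parent tree); first exact: leaf_in vL.
  by apply: contraNneq rL => <-.
pose M := [set v in leaves V A | r \in dominated E v].
pose X := leaves V A :\: M.
have ML : M \subset leaves V A by apply/subsetP=> v; rewrite inE => /andP[].
have cL : #|leaves V A| = #|M| + #|X| by rewrite -(cardsID M) (setIidPr ML).
case: (leqP k #|M|) => kM.
  have [||||v [s [Y [_ _ [sK _ _ par] cY]]]] := dominating_leaves_good useful tree (M := M).
  - by rewrite -card_gt0; lia.
  - by [].
  - by rewrite inE (negbTE rL).
  - by move=> v; rewrite inE => /andP[].
  have [B [BB cB]] := branching_of_reach sK par.
  by exists B; split=> //; rewrite -cY in kM; apply: leq_trans cB.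
have [v vL] : exists v, v \in leaves V A by apply/card_gt0P; lia.
have [s0 s0K] : exists s0, s0 \in roots E.
  by have [u _ /(tree_arc tree)/(useful_arc useful)[s sK _]] := parent v vL; exists s.
have [||H [HX cH rH]] := @half_hitting _ E (roots E) X r.
- by apply: subsetP (reach_root r s0K); apply: reachS => //; rewrite sub1set.
- move=> x /setDP[xL xM]; apply: contraT => xR; case/negP: xM.
  by rewrite inE xL dominatedE.
have [s sK rs] := reach_sourceP rH.
have YL : X :\: H \subset leaves V A by apply: subset_trans (subsetDl _ _) (subsetDl _ _).
have [|B [BB cB]] := branching_of_reach (Y := X :\: H) sK.
  move=> y yY; have [u ru uy] := parent y (subsetP YL _ yY).
  exists u; last exact: (tree_arc tree uy).
  (* The tree path from [r] to [u] runs through non-leaves, hence outside [X :\: H]. *)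
  apply: contraT => uR.
  have [a [b [aR bR ab bu]]] :=
    connect_leave (P := mem (reach E [set s] (X :\: H))) ru rs uR.
  case/negP: bR; apply: reach_step aR (tree_arc tree ab) _.
  apply/negP=> /(subsetP YL) bL.
  case/connectP: bu => -[|c p] /=.
    by move=> _ eu; move: (leaf_no_arc y bL); rewrite -eu uy.
  by case/andP=> bc _ _; move: (leaf_no_arc c bL); rewrite -/(arcs A b c) bc.
exists B; split=> //; apply: leq_trans cB.
(* Here |M| < k gives |X| > 2k, and [H] takes at most half of [X]. *)
rewrite cardsD (setIidPr HX); lia.
Qed.
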